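(* Let $a=1+a_2\mathbf j+a_3\mathbf k$ with $a_2,a_3\in\mathbb R$, $a_2^2+a_3^2=1$, let $b=b_1\mathbf i+b_2\mathbf j+b_3\mathbf k\ne0$ and $c=c_0+c_1\mathbf i+c_2\mathbf j+c_3\mathbf k\in\mathbb H_s$. Put $\delta=a_2b_3-a_3b_2+b_1$, and assume $P_{ab}=0$ and $\delta=0$. The equation $ax^2+bx+c=0$ has a solution $x\in\mathbb H_s$ with $2\Re(x)a+b\in Z(\mathbb H_s)$ if and only if $ac=2c$. If the equation is solvable, then we have the following cases, where $x=x_0+x_1\mathbf i+x_2\mathbf j+x_3\mathbf k$ with real $x_0,x_1,x_2,x_3$. (1) Case $x_0=0$: (1.1) if $a_2=0$, the equation has the solutions $x=x_1\mathbf i+x_2\mathbf j+\frac{c_1}{a_3b_1}\mathbf k$, where $$x_2=\frac{-a_3b_1\pm\sqrt{b_1^2-4\big(\frac{c_1^2}{b_1^2}+c_0-x_1^2-b_1x_1\big)}}{2}$$ and $x_1\in\mathbb R$ satisfies $x_1^2+b_1x_1+\frac{b_1^2}{4}-\frac{c_1^2}{b_1^2}-c_0\ge0$; (1.2) if $a_2\neq0$, the equation has the solutions $x=x_1\mathbf i+x_2\mathbf j+x_3\mathbf k$, where $x_3\in\mathbb R$ satisfies $$w=x_3^2-\Big(\frac{2a_3c_1+a_2b_1^2}{b_1}\Big)x_3+\frac{4(a_2^2b_1^2c_0+a_2b_1^2a_3c_1+c_1^2)+b_1^4a_2^2}{4b_1^2}\ge0,$$ $x_1=\frac{-b_1}{2}\pm\frac{\sqrt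 w}{a_2}$ and $x_2=\frac{c_1}{a_2b_1}-\frac{a_3}{a_2}x_3$. (2) Case $x_0\ne0$: (2.1) for $x_2,x_3\in\mathbb R$ with $a_2x_2+a_3x_3\neq\frac{c_1}{b_1}$, the equation has the solutions $x=T+x_1\mathbf i+x_2\mathbf j+x_3\mathbf k$, where $T$ is a real solution of $$z^4+2(a_2x_2+a_3x_3)z^3+\Big[(a_2x_2+a_3x_3)^2+b_1(a_3x_2-a_2x_3)+c_0+\frac{b_1^2}{4}\Big]z^2$$ $$+\big[a_2a_3b_1(x_2^2-x_3^2)+b_1(a_3^2-a_2^2)x_2x_3+c_1(a_2x_3-a_3x_2)\big]z-\frac{[b_1(a_2x_2+a_3x_3)-c_1]^2}{4}=0$$ and $x_1=\big(\frac{a_2b_1}{2T}-a_3\big)x_2+\big(\frac{a_3b_1}{2T}+a_2\big)x_3-\frac{c_1+b_1T}{2T}$; (2.2) when $a_2x_2+a_3x_3=\frac{c_1}{b_1}$, the equation has the solutions $x=x_0+x_1\mathbf i+x_2\mathbf j+x_3\mathbf k$ for all real $x_0\neq0$, where $$x_1=\frac1{b_1}x_0^2+\frac{2c_1}{b_1^2}x_0+\frac{c_1^2}{b_1^3}-\frac{b_1}{4}+\frac{c_0}{b_1},\quad x_2=\frac{a_2c_1}{b_1}-\frac{a_3b_1}{2}-a_3x_1,\quad x_3=\frac{a_3c_1}{b_1}+\frac{a_2b_1}{2}+a_2x_1.$$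
   Context: $\mathbb H_s$ is the split quaternion algebra: the 4-dimensional associative real algebra with basis $1,\mathbf i,\mathbf j,\mathbf k$ and $\mathbf i^2=-1$, $\mathbf j^2=\mathbf k^2=1$, $\mathbf i\mathbf j=\mathbf k=-\mathbf j\mathbf i$, $\mathbf j\mathbf k=-\mathbf i=-\mathbf k\mathbf j$, $\mathbf k\mathbf i=\mathbf j=-\mathbf i\mathbf k$. For $x=x_0+x_1\mathbf i+x_2\mathbf j+x_3\mathbf k$ and $y=y_0+y_1\mathbf i+y_2\mathbf j+y_3\mathbf k$ with real coefficients: $\Re(x)=x_0$, $P_{xy}=\langle x,y\rangle=x_0y_0+x_1y_1-x_2y_2-x_3y_3$, $I_x=\langle x,x\rangle$, $Z(\mathbb H_s)=\{x\in\mathbb H_s:I_x=0\}$. Under the hypotheses, $b_1\neq0$. *)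

(* Defs.v *)
From HB Require Import structures.
From mathcomp Require Import all_boot all_order all_algebra ring.
From mathcomp Require Import reals.

Set Implicit Arguments.
Unset Strict Implicit.
Unset Printing Implicit Defensive.

Import Order.TTheory GRing.Theory Num.Theory.
Local Open Scope ring_scope.

(* SplitQuat x0 x1 x2 x3 is x0 + x1 i + x2 j + x3 k (see splitquatE). *)
Record splitquat (R : Type) := SplitQuat { sq0 : R; sq1 : R; sq2 : R; sq3 : R }.

Section SplitQuaternions.
Variable R : comNzRingType.
Local Notation H := (splitquat R).
Implicit Types x y z : H.

Definition sq_to_tuple x := (sq0 x, sq1 x, sq2 x, sq3 x).
Definition sq_of_tuple (t : R * R * R * R) : H :=
  let: (x0, x1, x2, x3) := t in SplitQuat x0 x1 x2 x3.
Lemma sq_to_tupleK : cancel sq_to_tuple sq_of_tuple.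
Proof. by case. Qed.

HB.instance Definition _ := Choice.copy H (can_type sq_to_tupleK).

Definition sq_zero : H := SplitQuat 0 0 0 0.
Definition sq_opp x : H := SplitQuat (- sq0 x) (- sq1 x) (- sq2 x) (- sq3 x).
Definition sq_add x y : H :=
  SplitQuat (sq0 x + sq0 y) (sq1 x + sq1 y) (sq2 x + sq2 y) (sq3 x + sq3 y).

Fact sq_addA : associative sq_add.
Proof. by move=> [????] [????] [????]; congr SplitQuat; exact: addrA. Qed.
Fact sq_addC : commutative sq_add.
Proof. by move=> [????] [????]; congr SplitQuat; exact: addrC. Qed.
Fact sq_add0 : left_id sq_zero sq_add.
Proof. by move=> [????]; congr SplitQuat; exact: add0r. Qed.
Fact sq_addN : left_inverse sq_zero sq_opp sq_add.
Proof. by move=> [????]; congr SplitQuat; exact: addNr. Qed.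

HB.instance Definition _ :=
  GRing.isZmodule.Build H sq_addA sq_addC sq_add0 sq_addN.

(* Bilinear extension of i^2 = -1, j^2 = k^2 = 1, ij = k = -ji, jk = -i = -kj,
   ki = j = -ik; see splitquat_table. *)
Definition sq_one : H := SplitQuat 1 0 0 0.
Definition sq_mul x y : H :=
  let: SplitQuat x0 x1 x2 x3 := x in
  let: SplitQuat y0 y1 y2 y3 := y in
  SplitQuat (x0 * y0 - x1 * y1 + x2 * y2 + x3 * y3)
            (x0 * y1 + x1 * y0 - x2 * y3 + x3 * y2)
            (x0 * y2 + x2 * y0 - x1 * y3 + x3 * y1)
            (x0 * y3 + x3 * y0 + x1 * y2 - x2 * y1).

Fact sq_mulA : associative sq_mul.
Proof. by move=> [????] [????] [????]; congr SplitQuat; ring. Qed.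
Fact sq_mul1 : left_id sq_one sq_mul.
Proof. by move=> [????]; congr SplitQuat; ring. Qed.
Fact sq_mulr1 : right_id sq_one sq_mul.
Proof. by move=> [????]; congr SplitQuat; ring. Qed.
Fact sq_mulDl : left_distributive sq_mul +%R.
Proof. by move=> [????] [????] [????]; congr SplitQuat => /=; ring. Qed.
Fact sq_mulDr : right_distributive sq_mul +%R.
Proof. by move=> [????] [????] [????]; congr SplitQuat => /=; ring. Qed.
Fact sq_one_neq0 : sq_one != 0.
Proof. by apply/eqP => -[] /eqP; rewrite oner_eq0. Qed.

HB.instance Definition _ := GRing.Zmodule_isNzRing.Build H
  sq_mulA sq_mul1 sq_mulr1 sq_mulDl sq_mulDr sq_one_neq0.

Definition sq_scale (r : R) x : H :=
  SplitQuat (r * sq0 x) (r * sq1 x) (r * sq2 x) (r * sq3 x).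

Fact sq_scaleA r s x : sq_scale r (sq_scale s x) = sq_scale (r * s) x.
Proof. by congr SplitQuat; exact: mulrA. Qed.
Fact sq_scale1 : left_id 1 sq_scale.
Proof. by move=> [????]; congr SplitQuat; exact: mul1r. Qed.
Fact sq_scaleDr : right_distributive sq_scale +%R.
Proof. by move=> r x y; congr SplitQuat; exact: mulrDr. Qed.
Fact sq_scaleDl x : {morph sq_scale^~ x : r s / r + s}.
Proof. by move=> r s; congr SplitQuat; exact: mulrDl. Qed.

HB.instance Definition _ := GRing.Zmodule_isLmodule.Build R H
  sq_scaleA sq_scale1 sq_scaleDr sq_scaleDl.

Fact sq_scaleAl (r : R) x y : r *: (x * y) = (r *: x) * y.
Proof. by case: x y => [????] [????]; congr SplitQuat => /=; ring. Qed.

HB.instance Definition _ := GRing.Lmodule_isLalgebra.Build R H sq_scaleAl.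

Fact sq_scaleAr (r : R) x y : r *: (x * y) = x * (r *: y).
Proof. by case: x y => [????] [????]; congr SplitQuat => /=; ring. Qed.

HB.instance Definition _ := GRing.Lalgebra_isAlgebra.Build R H sq_scaleAr.

Definition sqi : H := SplitQuat 0 1 0 0.
Definition sqj : H := SplitQuat 0 0 1 0.
Definition sqk : H := SplitQuat 0 0 0 1.

Definition sqRe x : R := sq0 x.

(* P_{xy} = <x, y> and I_x = <x, x> *)
Definition sqP x y : R :=
  sq0 x * sq0 y + sq1 x * sq1 y - sq2 x * sq2 y - sq3 x * sq3 y.
Definition sqI x : R := sqP x x.

(* Z(H_s) *)
Definition sqZ : {pred H} := [pred x | sqI x == 0].

Definition quad_sol (a b c x : H) : Prop := a * x ^+ 2 + b * x + c = 0.

End SplitQuaternions.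

Arguments sqi {R}.
Arguments sqj {R}.
Arguments sqk {R}.

Lemma splitquatE (R : comNzRingType) (x0 x1 x2 x3 : R) :
  x0%:A + x1 *: sqi + x2 *: sqj + x3 *: sqk = SplitQuat x0 x1 x2 x3.
Proof. by congr SplitQuat => /=; ring. Qed.

Lemma splitquat_table (R : comNzRingType) (i := @sqi R) (j := @sqj R)
    (k := @sqk R) :
  [/\ i * i = -1, j * j = 1 & k * k = 1] /\
  [/\ i * j = k, j * i = - k, j * k = - i & k * j = i] /\
  [/\ k * i = j & i * k = - j].
Proof. by do ![split]; congr SplitQuat => /=; ring. Qed.

(* Main.v *)
Require Import Defs.
From mathcomp Require Import all_boot all_order all_algebra ring.
From mathcomp Require Import reals.

Import Order.TTheory GRing.Theory Num.Theory.
Local Open Scope ring_scope.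

(** The coefficient [a] satisfies [a * a = 2 a], and the two conditions on [b]
    force [b = b1 (a i)], so the equation reads
    [a (x^2 + b1 i x) + c = 0].  The right ideal [a H] consists of the [c] with
    [a c = 2 c]; hence a solvable equation has [c] in [a H].  This ideal is a
    real plane on which the components along [1] and [i] are coordinates
    ([singular_idealE]), so for such a [c] the equation amounts to two real
    equations.

    They become short in the coordinates [p = a2 x2 + a3 x3] and
    [q = a3 x2 - a2 x3], an orthogonal change of variables in the plane of [j]
    and [k] ([quad_solE]):
      [(x0 + p)^2 + (q - x1) (q + x1 + b1) + c0 = 0],
      [2 x0 (x1 + q) + b1 (x0 - p) + c1 = 0].
    If [x0 = 0], the second equation fixes [p = c1 / b1] and the first one is
    the conic
    [(x1 + b1/2)^2 = (q + b1/2)^2 + p^2 + c0] ([system_re0]).  If [a2 = 0],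
    then [p] determines [x3], and the conic is solved for [x2] with a square
    root ([conic_a2_eq0]); otherwise [p] expresses [x2] by [x3], and the conic
    is solved for [x1] ([conic_a2_neq0]).
    If [x0 <> 0], the second equation gives [x1] and substitution in the first
    one leaves the quartic in [x0] ([system_reN0]).  Its constant term is
    [- (b1 p - c1)^2 / 4]: when [b1 p <> c1], the value 0 is not a root, so
    for given [x2] and [x3] the nonzero real parts of solutions are exactly the
    roots of the quartic.  When
    [b1 p = c1], the quartic is [x0^2] times an expression linear in [q], so
    every [x0 <> 0] occurs with exactly one [q] ([system_degenerate]).  This
    last family is never empty, so [a c = 2 c] is sufficient for solvability.
    Finally [2 Re(x) a + b = a (2 Re(x) + b1 i)] is a multiple of the zero
    divisor [a], hence lies in the null cone for every [x]. *)

(** * Reduction to two real equations *)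

Lemma splitquat_imE (R : comNzRingType) (x1 x2 x3 : R) :
  x1 *: sqi + x2 *: sqj + x3 *: sqk = SplitQuat 0 x1 x2 x3.
Proof. by congr SplitQuat => /=; ring. Qed.

Lemma splitquat_1jkE (R : comNzRingType) (a2 a3 : R) :
  1 + a2 *: sqj + a3 *: sqk = SplitQuat 1 0 a2 a3.
Proof. by congr SplitQuat => /=; ring. Qed.

(** The cofactor [k] turns a deduction from the equation [u = v] into a ring
    identity. *)
Lemma eq_cofactor (R : pzRingType) (k u v x y : R) :
  u = v -> x - y = k * (u - v) -> x = y.
Proof. by move=> ->; rewrite subrr mulr0 => /subr0_eq. Qed.
Arguments eq_cofactor {R} k {u v x y}.

(** The two conditions are a linear system for [(b2, b3)] whose matrix is a
    rotation. *)
Lemma linear_coefE (R : comNzRingType) (a2 a3 b1 b2 b3 : R) :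
    a2 ^+ 2 + a3 ^+ 2 = 1 -> a2 * b2 + a3 * b3 = 0 ->
    a2 * b3 - a3 * b2 + b1 = 0 ->
  b2 = a3 * b1 /\ b3 = - (a2 * b1).
Proof.
move=> ha hP hd.
have b1E : b1 = a3 * b2 - a2 * b3 by apply: (eq_cofactor 1 hd); ring.
split.
  apply: (eq_cofactor (- b2) ha); rewrite b1E.
  by apply: (eq_cofactor a2 hP); ring.
apply: (eq_cofactor (- b3) ha); rewrite b1E.
by apply: (eq_cofactor a3 hP); ring.
Qed.

(** As [a^2 = 2 a], the condition characterizes the right ideal [a H].  This is
    spanned by [a] and [a i = i + a3 j - a2 k], so its elements are
    [c0 a + c1 (a i)]. *)
Lemma singular_idealE (R : comNzRingType) (a2 a3 c0 c1 c2 c3 : R) :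
    a2 ^+ 2 + a3 ^+ 2 = 1 ->
  SplitQuat 1 0 a2 a3 * SplitQuat c0 c1 c2 c3 =
    2 *: SplitQuat c0 c1 c2 c3 <->
  c2 = a2 * c0 + a3 * c1 /\ c3 = a3 * c0 - a2 * c1.
Proof.
move=> ha.
have -> : 2 *: SplitQuat c0 c1 c2 c3 =
  SplitQuat (2 * c0) (2 * c1) (2 * c2) (2 * c3) by [].
split=> [[_ _ h2 h3]|[-> ->]].
  by split; [apply: (eq_cofactor (-1) h2)|apply: (eq_cofactor (-1) h3)]; ring.
have ha3 : a3 ^+ 2 = 1 - a2 ^+ 2 by rewrite -ha addrC addKr.
by congr SplitQuat; ring: ha3.
Qed.

(** Since [a^2 = 2 a] and [a b = 2 b], any value [- (a x^2 + b x)] lies in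
    [a H]. *)
Lemma quad_sol_ideal (R : comNzRingType) (a b c x : splitquat R) :
  a * a = 2 *: a -> a * b = 2 *: b -> quad_sol a b c x -> a * c = 2 *: c.
Proof.
move=> haa hab; rewrite /quad_sol => /eqP.
rewrite addrC addr_eq0 => /eqP ->.
by rewrite mulrN mulrDr !mulrA haa hab -!scalerAl -scalerDr scalerN.
Qed.

Lemma quad_solE (R : comNzRingType) (a2 a3 b1 c0 c1 x0 x1 x2 x3 : R) :
    a2 ^+ 2 + a3 ^+ 2 = 1 ->
    let p := a2 * x2 + a3 * x3 in let q := a3 * x2 - a2 * x3 in
  quad_sol (SplitQuat 1 0 a2 a3) (SplitQuat 0 b1 (a3 * b1) (- (a2 * b1)))
    (SplitQuat c0 c1 (a2 * c0 + a3 * c1) (a3 * c0 - a2 * c1))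
    (SplitQuat x0 x1 x2 x3) <->
  (x0 + p) ^+ 2 + (q - x1) * (q + x1 + b1) + c0 = 0 /\
  2 * x0 * (x1 + q) + b1 * (x0 - p) + c1 = 0.
Proof.
move=> ha p q.
have ha3 : a3 ^+ 2 = 1 - a2 ^+ 2 by rewrite -ha addrC addKr.
set e0 := (X in X = 0 /\ _); set e1 := (X in _ /\ X = 0).
(* The left-hand side is [a (e0 + e1 i)]. *)
have E : SplitQuat 1 0 a2 a3 * SplitQuat x0 x1 x2 x3 ^+ 2 +
    SplitQuat 0 b1 (a3 * b1) (- (a2 * b1)) * SplitQuat x0 x1 x2 x3 +
    SplitQuat c0 c1 (a2 * c0 + a3 * c1) (a3 * c0 - a2 * c1) =
    SplitQuat e0 e1 (a2 * e0 + a3 * e1) (a3 * e0 - a2 * e1).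
  by rewrite expr2 /e0 /e1 /p /q; congr SplitQuat => /=; ring: ha3.
rewrite /quad_sol E; split=> [[-> ->] //|[-> ->]].
by congr SplitQuat; ring.
Qed.

(** The element is [a (r + b1 i)]; the quadratic form is multiplicative and
    vanishes at [a]. *)
Lemma singular_combination_null (R : comNzRingType) (a2 a3 b1 r : R) :
    a2 ^+ 2 + a3 ^+ 2 = 1 ->
  r *: SplitQuat 1 0 a2 a3 + SplitQuat 0 b1 (a3 * b1) (- (a2 * b1)) \in @sqZ R.
Proof.
move=> ha; have ha3 : a3 ^+ 2 = 1 - a2 ^+ 2 by rewrite -ha addrC addKr.
by rewrite inE /sqI /sqP /=; apply/eqP; ring: ha3.
Qed.

(** * Solving the real system *)

Lemma sqr_eq_sqrtP (R : rcfType) (y d : R) :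
  y ^+ 2 = d <-> 0 <= d /\ (y = Num.sqrt d \/ y = - Num.sqrt d).
Proof.
split=> [<-|[d0 [] ->]]; rewrite ?sqrrN ?sqr_sqrtr //.
split; first exact: sqr_ge0.
by rewrite sqrtr_sqr; case: (ger0P y) => _; [left|right; rewrite opprK].
Qed.

Lemma system_re0 (F : numFieldType) (b1 c0 c1 x1 p q : F) : b1 != 0 ->
  (0 + p) ^+ 2 + (q - x1) * (q + x1 + b1) + c0 = 0 /\
  2 * 0 * (x1 + q) + b1 * (0 - p) + c1 = 0 <->
  p = c1 / b1 /\ (x1 + b1 / 2) ^+ 2 = (q + b1 / 2) ^+ 2 + p ^+ 2 + c0.
Proof.
move=> b1N0; split=> [[h0 h1]|[pE h]].
  split; first by apply: (eq_cofactor (- b1^-1) h1); field.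
  by apply: (eq_cofactor (-1) h0); field.
split; last by rewrite pE; field.
by apply: (eq_cofactor (-1) h); field.
Qed.

(** Here [p = a3 x3] and [q = a3 x2]; on the conic, the discriminant is the
    square of [2 x2 + a3 b1 = a3 (2 q + b1)]. *)
Lemma conic_a2_eq0 (R : rcfType) (a2 a3 b1 c0 c1 x1 x2 x3 : R) :
    a2 ^+ 2 + a3 ^+ 2 = 1 -> b1 != 0 -> a2 = 0 ->
    let p := a2 * x2 + a3 * x3 in let q := a3 * x2 - a2 * x3 in
    let D := b1 ^+ 2 - 4 * (c1 ^+ 2 / b1 ^+ 2 + c0 - x1 ^+ 2 - b1 * x1) in
  p = c1 / b1 /\
    (x1 + b1 / 2) ^+ 2 = (q + b1 / 2) ^+ 2 + p ^+ 2 + c0 <->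
  [/\ 0 <= x1 ^+ 2 + b1 * x1 + b1 ^+ 2 / 4 - c1 ^+ 2 / b1 ^+ 2 - c0,
      x2 = (- (a3 * b1) + Num.sqrt D) / 2 \/
      x2 = (- (a3 * b1) - Num.sqrt D) / 2
    & x3 = c1 / (a3 * b1)].
Proof.
move=> + b1N0 a20 p q D; rewrite /p /q a20 expr0n /= !mul0r !add0r subr0 => ha3.
have a3N0 : a3 != 0 by rewrite -sqrf_eq0 ha3 oner_eq0.
have -> : 0 <= x1 ^+ 2 + b1 * x1 + b1 ^+ 2 / 4 - c1 ^+ 2 / b1 ^+ 2 - c0 =
    (0 <= D).
  rewrite -(pmulr_rge0 _ (ltr0n R 4)); congr (0 <= _).
  by rewrite /D; field.
have x3E : a3 * x3 = c1 / b1 <-> x3 = c1 / (a3 * b1).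
  split=> [h|->]; last by field; apply/andP.
  by apply: (mulfI a3N0); rewrite h; field; apply/andP.
have DE : a3 * x3 = c1 / b1 ->
    (x1 + b1 / 2) ^+ 2 = (a3 * x2 + b1 / 2) ^+ 2 + (a3 * x3) ^+ 2 + c0 <->
    (2 * x2 + a3 * b1) ^+ 2 = D.
  have -> : (2 * x2 + a3 * b1) ^+ 2 = 4 * (a3 * x2 + b1 / 2) ^+ 2.
    by apply: (eq_cofactor (b1 ^+ 2 - 4 * x2 ^+ 2) ha3); field.
  move=> ->; rewrite /D; split=> h.
    by apply: (eq_cofactor (-4) h); field.
  by apply: (eq_cofactor (- 4^-1) h); field.
split=> [[hp /(DE hp) /sqr_eq_sqrtP[D0 hs]]|[D0 hs /x3E hp]].
  split; [by []| |exact/x3E].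
  by case: hs => hs; [left|right]; apply: (eq_cofactor 2^-1 hs); field.
split; first exact: hp.
apply/(DE hp)/sqr_eq_sqrtP; split=> //.
by case: hs => ->; [left|right]; field.
Qed.

(** Eliminating [x2] from the conic leaves [(a2 (x1 + b1 / 2))^2 = w]. *)
Lemma conic_a2_neq0 (R : rcfType) (a2 a3 b1 c0 c1 x1 x2 x3 : R) :
    a2 ^+ 2 + a3 ^+ 2 = 1 -> b1 != 0 -> a2 != 0 ->
    let p := a2 * x2 + a3 * x3 in let q := a3 * x2 - a2 * x3 in
    let w := x3 ^+ 2 - ((2 * a3 * c1 + a2 * b1 ^+ 2) / b1) * x3
          + (4 * (a2 ^+ 2 * b1 ^+ 2 * c0 + a2 * b1 ^+ 2 * a3 * c1 + c1 ^+ 2)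
             + b1 ^+ 4 * a2 ^+ 2) / (4 * b1 ^+ 2) in
  p = c1 / b1 /\
    (x1 + b1 / 2) ^+ 2 = (q + b1 / 2) ^+ 2 + p ^+ 2 + c0 <->
  [/\ 0 <= w,
      x1 = - b1 / 2 + Num.sqrt w / a2 \/ x1 = - b1 / 2 - Num.sqrt w / a2
    & x2 = c1 / (a2 * b1) - a3 / a2 * x3].
Proof.
move=> ha b1N0 a2N0 p q w.
have ha3 : a3 ^+ 2 = 1 - a2 ^+ 2 by rewrite -ha addrC addKr.
have x2E : p = c1 / b1 <-> x2 = c1 / (a2 * b1) - a3 / a2 * x3.
  rewrite /p; split=> [h|->]; last by field; apply/andP.
  by apply: (eq_cofactor a2^-1 h); field; apply/andP.
have wE : p = c1 / b1 ->
    (x1 + b1 / 2) ^+ 2 = (q + b1 / 2) ^+ 2 + p ^+ 2 + c0 <->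
    (a2 * (x1 + b1 / 2)) ^+ 2 = w.
  move=> hp.
  have -> : w = a2 ^+ 2 * ((q + b1 / 2) ^+ 2 + p ^+ 2 + c0).
    have -> : q = (a3 * (c1 / b1) - x3) / a2.
      rewrite /q (x2E.1 hp).
      by apply: (eq_cofactor (- (x3 / a2)) ha); field; apply/andP.
    rewrite hp /w.
    by apply: (eq_cofactor (- (c1 / b1) ^+ 2) ha); field; apply/andP.
  rewrite exprMn; split=> [-> //|].
  by apply: mulfI; rewrite sqrf_eq0.
split=> [[hp /(wE hp) /sqr_eq_sqrtP[w0 hs]]|[w0 hs /x2E hp]].
  split; [by []| |exact/x2E].
  by case: hs => hs; [left|right]; apply: (eq_cofactor a2^-1 hs); field.
split; first exact: hp.
apply/(wE hp)/sqr_eq_sqrtP; split=> //.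
by case: hs => ->; [left|right]; field.
Qed.

(** The first equation times [x0^2] becomes the quartic once [x1] is
    eliminated. *)
Lemma system_reN0 (F : numFieldType) (b1 c0 c1 x0 x1 p q : F) : x0 != 0 ->
  (x0 + p) ^+ 2 + (q - x1) * (q + x1 + b1) + c0 = 0 /\
  2 * x0 * (x1 + q) + b1 * (x0 - p) + c1 = 0 <->
  x1 = - q - (b1 * (x0 - p) + c1) / (2 * x0) /\
  x0 ^+ 4 + 2 * p * x0 ^+ 3 + (p ^+ 2 + b1 * q + c0 + b1 ^+ 2 / 4) * x0 ^+ 2
    + (b1 * p - c1) * q * x0 - (b1 * p - c1) ^+ 2 / 4 = 0.
Proof.
move=> x0N0; split=> [[h0 h1]|[-> h]].
  have x1E : x1 = - q - (b1 * (x0 - p) + c1) / (2 * x0).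
    by apply: (eq_cofactor (2 * x0)^-1 h1); field.
  split=> //; rewrite x1E in h0.
  by apply: (eq_cofactor (x0 ^+ 2) h0); field.
split; last by field.
by apply: (eq_cofactor (x0 ^- 2) h); field.
Qed.

(** When [b1 p = c1] the quartic is [x0^2] times an expression linear in [q],
    and the second equation reads [q = - x1 - b1 / 2]. *)
Lemma system_degenerate (F : numFieldType) (b1 c0 c1 x0 x1 p q : F) :
    b1 != 0 -> x0 != 0 -> p = c1 / b1 ->
  (x0 + p) ^+ 2 + (q - x1) * (q + x1 + b1) + c0 = 0 /\
  2 * x0 * (x1 + q) + b1 * (x0 - p) + c1 = 0 <->
  x1 = 1 / b1 * x0 ^+ 2 + 2 * c1 / b1 ^+ 2 * x0 + c1 ^+ 2 / b1 ^+ 3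
         - b1 / 4 + c0 / b1 /\
  q = - x1 - b1 / 2.
Proof.
move=> b1N0 x0N0 pE; split=> [[h0 h1]|[x1E qE]].
  have qE : q = - x1 - b1 / 2.
    by apply: (eq_cofactor (2 * x0)^-1 h1); rewrite pE; field; apply/andP.
  split=> //; rewrite qE pE in h0.
  by apply: (eq_cofactor (- b1^-1) h0); field.
by rewrite qE pE x1E; split; field.
Qed.

(** The change of variables [(x2, x3) |-> (p, q)] is a reflection, hence its own
    inverse. *)
Lemma reflectionE (R : comNzRingType) (a2 a3 x2 x3 p q : R) :
    a2 ^+ 2 + a3 ^+ 2 = 1 ->
  a2 * x2 + a3 * x3 = p /\ a3 * x2 - a2 * x3 = q <->
  x2 = a2 * p + a3 * q /\ x3 = a3 * p - a2 * q.
Proof.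
move=> ha; have ha3 : a3 ^+ 2 = 1 - a2 ^+ 2 by rewrite -ha addrC addKr.
by split=> [[<- <-]|[-> ->]]; split; ring: ha3.
Qed.

Theorem theorem5p3 (R : realType) (a b c : splitquat R)
  (a2 a3 b1 b2 b3 c0 c1 c2 c3 : R)
  (ha : a = 1 + a2 *: sqj + a3 *: sqk)
  (ha23 : a2 ^+ 2 + a3 ^+ 2 = 1)
  (hb : b = b1 *: sqi + b2 *: sqj + b3 *: sqk)
  (hb0 : b <> 0)
  (hc : c = c0%:A + c1 *: sqi + c2 *: sqj + c3 *: sqk)
  (hP : sqP a b = 0)
  (hdelta : a2 * b3 - a3 * b2 + b1 = 0) :
  ((exists x, quad_sol a b c x /\ (2 * sqRe x) *: a + b \in @sqZ R)
     <-> a * c = 2 *: c) /\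
  ((exists x, quad_sol a b c x) ->
   (* (1.1) *)
   (a2 = 0 ->
    forall x, (quad_sol a b c x /\ sqRe x = 0) <->
      exists x1 x2 : R,
        let D := b1 ^+ 2 - 4 * (c1 ^+ 2 / b1 ^+ 2 + c0 - x1 ^+ 2 - b1 * x1) in
        [/\ 0 <= x1 ^+ 2 + b1 * x1 + b1 ^+ 2 / 4 - c1 ^+ 2 / b1 ^+ 2 - c0,
            x2 = (- (a3 * b1) + Num.sqrt D) / 2 \/
            x2 = (- (a3 * b1) - Num.sqrt D) / 2
          & x = x1 *: sqi + x2 *: sqj + (c1 / (a3 * b1)) *: sqk]) /\
   (* (1.2) *)
   (a2 <> 0 ->
    forall x, (quad_sol a b c x /\ sqRe x = 0) <->
      exists x1 x2 x3 : R,
        let w := x3 ^+ 2 - ((2 * a3 * c1 + a2 * b1 ^+ 2) / b1) * x3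
          + (4 * (a2 ^+ 2 * b1 ^+ 2 * c0 + a2 * b1 ^+ 2 * a3 * c1 + c1 ^+ 2)
             + b1 ^+ 4 * a2 ^+ 2) / (4 * b1 ^+ 2) in
        [/\ 0 <= w,
            x1 = - b1 / 2 + Num.sqrt w / a2 \/
            x1 = - b1 / 2 - Num.sqrt w / a2,
            x2 = c1 / (a2 * b1) - a3 / a2 * x3
          & x = x1 *: sqi + x2 *: sqj + x3 *: sqk]) /\
   (* (2.1) *)
   (forall x2 x3 : R, a2 * x2 + a3 * x3 <> c1 / b1 ->
    forall x,
      [/\ quad_sol a b c x, sqRe x <> 0, sq2 x = x2 & sq3 x = x3] <->
      exists T x1 : R,
        [/\ T ^+ 4 + 2 * (a2 * x2 + a3 * x3) * T ^+ 3
            + ((a2 * x2 + a3 * x3) ^+ 2 + b1 * (a3 * x2 - a2 * x3)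
               + c0 + b1 ^+ 2 / 4) * T ^+ 2
            + (a2 * a3 * b1 * (x2 ^+ 2 - x3 ^+ 2)
               + b1 * (a3 ^+ 2 - a2 ^+ 2) * x2 * x3
               + c1 * (a2 * x3 - a3 * x2)) * T
            - (b1 * (a2 * x2 + a3 * x3) - c1) ^+ 2 / 4 = 0,
            x1 = (a2 * b1 / (2 * T) - a3) * x2 + (a3 * b1 / (2 * T) + a2) * x3
                 - (c1 + b1 * T) / (2 * T)
          & x = T%:A + x1 *: sqi + x2 *: sqj + x3 *: sqk]) /\
   (* (2.2) *)
   (forall x,
      [/\ quad_sol a b c x, sqRe x <> 0
        & a2 * sq2 x + a3 * sq3 x = c1 / b1] <->
      exists x0 x1 x2 x3 : R,
        [/\ x0 <> 0,
            x1 = 1 / b1 * x0 ^+ 2 + 2 * c1 / b1 ^+ 2 * x0 + c1 ^+ 2 / b1 ^+ 3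
                 - b1 / 4 + c0 / b1,
            x2 = a2 * c1 / b1 - a3 * b1 / 2 - a3 * x1,
            x3 = a3 * c1 / b1 + a2 * b1 / 2 + a2 * x1
          & x = x0%:A + x1 *: sqi + x2 *: sqj + x3 *: sqk])).
Proof.
have hP' : a2 * b2 + a3 * b3 = 0.
  have := hP; rewrite ha hb splitquat_1jkE splitquat_imE /sqP /= => h.
  by apply: (eq_cofactor (-1) h); ring.
have [b2E b3E] := linear_coefE _ _ _ _ _ _ ha23 hP' hdelta.
have b1N0 : b1 != 0.
  apply/eqP=> b10; apply: hb0.
  by rewrite hb b2E b3E b10 !mulr0 oppr0 !scale0r !addr0.
move: ha hb hc; rewrite splitquat_1jkE b2E b3E splitquat_imE splitquatE.
move=> {hP hP' hdelta hb0 b2 b3 b2E b3E} aE bE cE.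
have sol_ideal x : quad_sol a b c x -> a * c = 2 *: c.
  apply: quad_sol_ideal; rewrite aE ?bE; apply/singular_idealE => //.
    by split; ring.
  by split; ring.
have solE x0 x1 x2 x3 : a * c = 2 *: c ->
    quad_sol a b c (SplitQuat x0 x1 x2 x3) <->
    (x0 + (a2 * x2 + a3 * x3)) ^+ 2
      + (a3 * x2 - a2 * x3 - x1) * (a3 * x2 - a2 * x3 + x1 + b1) + c0 = 0 /\
    2 * x0 * (x1 + (a3 * x2 - a2 * x3))
      + b1 * (x0 - (a2 * x2 + a3 * x3)) + c1 = 0.
  rewrite aE bE cE => /(singular_idealE _ _ _ _ _ _ _ ha23)[-> ->].
  exact: quad_solE.
(* These are the values of [p] and [q] in the degenerate case [b1 p = c1]. *)
have x23E x1 x2 x3 :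
    a2 * x2 + a3 * x3 = c1 / b1 /\ a3 * x2 - a2 * x3 = - x1 - b1 / 2 <->
    x2 = a2 * c1 / b1 - a3 * b1 / 2 - a3 * x1 /\
    x3 = a3 * c1 / b1 + a2 * b1 / 2 + a2 * x1.
  rewrite (reflectionE _ _ _ _ _ _ _ ha23).
  by split=> -[-> ->]; split; field.
split.
  split=> [[x [/sol_ideal]] //|hac].
  (* The solution with real part 1 and [p = c1 / b1]. *)
  pose x1 := 1 / b1 * 1 ^+ 2 + 2 * c1 / b1 ^+ 2 * 1 + c1 ^+ 2 / b1 ^+ 3
    - b1 / 4 + c0 / b1.
  have [hp hq] := (x23E x1 _ _).2 (conj erefl erefl).
  eexists (SplitQuat 1 x1 _ _); split; last first.
    by rewrite aE bE; exact: singular_combination_null.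
  by apply/(solE _ _ _ _ hac)/(system_degenerate _ _ _ _ _ _ _ _ _ _ hp);
    rewrite ?oner_neq0.
case=> y /sol_ideal hac.
have sol0E x1 x2 x3 : quad_sol a b c (SplitQuat 0 x1 x2 x3) <->
    a2 * x2 + a3 * x3 = c1 / b1 /\
    (x1 + b1 / 2) ^+ 2 =
      (a3 * x2 - a2 * x3 + b1 / 2) ^+ 2 + (a2 * x2 + a3 * x3) ^+ 2 + c0.
  exact: iff_trans (solE 0 x1 x2 x3 hac) (system_re0 _ _ _ _ _ _ _ b1N0).
split; last split; last split.
- move=> a20 x; split=> [[]|[x1 [x2 [D0 x2E ->]]]].
    case: x => x0 x1 x2 x3 + x00; rewrite /sqRe /= in x00 *; subst x0.
    move=> /sol0E /(conic_a2_eq0 _ _ _ _ _ _ _ _ _ ha23 b1N0 a20)[D0 x2E ->].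
    by exists x1, x2; split=> //; rewrite splitquat_imE.
  rewrite splitquat_imE; split=> //; apply/sol0E.
  exact/(conic_a2_eq0 _ _ _ _ _ _ _ _ _ ha23 b1N0 a20).
- move=> /eqP a2N0 x; split=> [[]|[x1 [x2 [x3 [w0 x1E x2E ->]]]]].
    case: x => x0 x1 x2 x3 + x00; rewrite /sqRe /= in x00 *; subst x0.
    move=> /sol0E /(conic_a2_neq0 _ _ _ _ _ _ _ _ _ ha23 b1N0 a2N0).
    by case=> w0 x1E x2E; exists x1, x2, x3; split=> //; rewrite splitquat_imE.
  rewrite splitquat_imE; split=> //; apply/sol0E.
  exact/(conic_a2_neq0 _ _ _ _ _ _ _ _ _ ha23 b1N0 a2N0).
- move=> x2 x3 pN x.
  have -> : a2 * a3 * b1 * (x2 ^+ 2 - x3 ^+ 2)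
      + b1 * (a3 ^+ 2 - a2 ^+ 2) * x2 * x3 + c1 * (a2 * x3 - a3 * x2) =
    (b1 * (a2 * x2 + a3 * x3) - c1) * (a3 * x2 - a2 * x3) by ring.
  have x1E T : T != 0 ->
      (a2 * b1 / (2 * T) - a3) * x2 + (a3 * b1 / (2 * T) + a2) * x3
        - (c1 + b1 * T) / (2 * T) =
      - (a3 * x2 - a2 * x3) - (b1 * (T - (a2 * x2 + a3 * x3)) + c1) / (2 * T).
    by move=> T0; field.
  split=> [[]|[T [x1 [hT -> ->]]]].
    case: x => T x1 y2 y3; rewrite /sqRe /= => + /eqP T0 y2E y3E.
    move: y2E y3E => -> -> /(solE _ _ _ _ hac).
    move=> /(system_reN0 _ _ _ _ _ _ _ _ T0)[hx1 hT].
    by exists T, x1; split; rewrite ?splitquatE ?x1E.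
  (* At [T = 0] only the constant term of the quartic is left. *)
  have T0 : T != 0.
    apply/eqP=> T0; apply: pN; move: hT; rewrite T0 !expr0n /= !mulr0 !add0r.
    move/eqP; rewrite oppr_eq0 mulf_eq0 invr_eq0 pnatr_eq0 orbF sqrf_eq0.
    by rewrite subr_eq0 => /eqP <-; rewrite mulrAC mulfV // mul1r.
  rewrite splitquatE; split=> //; last exact/eqP.
  by apply/(solE _ _ _ _ hac)/(system_reN0 _ _ _ _ _ _ _ _ T0); rewrite x1E.
- move=> x; split=> [[]|[x0 [x1 [x2 [x3 [/eqP x0N0 x1E x2E x3E ->]]]]]].
    case: x => x0 x1 x2 x3; rewrite /sqRe /= => + /eqP x0N0 hp.
    move=> /(solE _ _ _ _ hac).
    move=> /(system_degenerate _ _ _ _ _ _ _ _ b1N0 x0N0 hp)[x1E hq].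
    have [x2E x3E] := (x23E _ _ _).1 (conj hp hq).
    exists x0, x1, x2, x3; split=> //; first exact/eqP.
    by rewrite splitquatE.
  have [hp hq] := (x23E _ _ _).2 (conj x2E x3E).
  rewrite splitquatE; split=> //; last exact/eqP.
  apply/(solE _ _ _ _ hac).
  exact/(system_degenerate _ _ _ _ _ _ _ _ b1N0 x0N0 hp).
Qed.
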